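(* Let $N\ge 4$, and let $\bm{\Psi}^N=\{\Psi^N_{\bm{q}_1,\bm{q}_2}\}_{\bm{q}_1,\bm{q}_2}$, where $\bm{q}_1,\bm{q}_2$ range over all permutations of $\{1,\dots,N\}$. Then the number of functionally independent functions in $\bm{\Psi}^N$ is exactly $N-3$: there exist $N-3$ elements of $\bm{\Psi}^N$ that are functionally independent, and no $N-2$ elements of $\bm{\Psi}^N$ are functionally independent.
   Context: Let $X_N$ be the set of $\bm{\theta}_N=(\theta_1,\dots,\theta_N)\in\mathbb{R}^N$ with $\theta_i\not\equiv\theta_j\pmod{2\pi}$ for all $i\ne j$. For a permutation $\bm{q}=(q^{(1)},\dots,q^{(N)})$ of $\{1,\dots,N\}$, with the cyclic convention $q^{(N+1)}:=q^{(1)}$, define on $X_N$ $$\psi^N_{\bm{q}}(\bm{\theta}_N):=\frac{1}{\prod_{j=1}^N\sin\left(\frac{\theta_{q^{(j)}}-\theta_{q^{(j+1)}}}{2}\right)},\qquad \Psi^N_{\bm{q}_1,\bm{q}_2}(\bm{\theta}_N):=\frac{\psi^N_{\bm{q}_2}(\bm{\theta}_N)}{\psi^N_{\bm{q}_1}(\bm{\theta}_N)}.$$ Smooth functions $w_1,\dots,w_m$ on $X_N$ are called functionally independent if their differentials $dw_1,\dots,dw_m$ are linearly independent at every point of some open dense subset of $X_N$. (In particular, constant functions are never part of a functionally independent family.) *)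

(* Defs.v *)
From HB Require Import structures.
From mathcomp Require Import all_boot all_order all_algebra all_fingroup.
From mathcomp Require Import all_classical all_reals all_analysis.

Set Implicit Arguments.
Unset Strict Implicit.
Unset Printing Implicit Defensive.

Import Order.TTheory GRing.Theory Num.Theory.
Import numFieldNormedType.Exports.

Local Open Scope classical_set_scope.
Local Open Scope ring_scope.

(* The labels 1, ..., N are encoded as 'I_N = {0, ..., N-1}, and a point
   (theta_1, ..., theta_N) of R^N as a row vector. *)
Definition config_space (R : realType) (N : nat) : set 'rV[R]_N :=
  [set theta | forall i j : 'I_N, i != j ->
     ~ exists k : int, theta ord0 i - theta ord0 j = k%:~R * (2 * pi)].

(* [ordS] is the successor modulo N: it carries the convention
   q^(N+1) = q^(1). On [config_space R N] every sine below is nonzero when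
   N >= 2, so there the total inverse and quotient are the genuine ones and
   the functions are smooth; their values elsewhere are irrelevant. *)
Definition psi (R : realType) (N : nat) (q : 'S_N) (theta : 'rV[R]_N) : R :=
  (\prod_(j < N) sin ((theta ord0 (q j) - theta ord0 (q (ordS j))) / 2))^-1.

Definition Psi (R : realType) (N : nat) (q1 q2 : 'S_N) (theta : 'rV[R]_N) : R :=
  psi q2 theta / psi q1 theta.

Definition Psi_set (R : realType) (N : nat) : set ('rV[R]_N -> R) :=
  [set w | exists q1 q2 : 'S_N, w = @Psi R N q1 q2].

Definition differentials_independent (R : realType) (N m : nat)
    (w : 'I_m -> 'rV[R]_N -> R) (theta : 'rV[R]_N) : Prop :=
  forall c : 'I_m -> R,
    (forall v : 'rV[R]_N, \sum_(i < m) c i * 'd (w i) theta v = 0) ->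
    forall i, c i = 0.

(* [config_space R N] is open in R^N, so its relatively open subsets are its
   subsets that are open in R^N; as U lies in it, 'd (w i) theta for theta in U
   depends only on the restriction of w i to [config_space R N]. The notion is
   meant for w i smooth on [config_space R N]. *)
Definition functionally_independent (R : realType) (N m : nat)
    (w : 'I_m -> 'rV[R]_N -> R) : Prop :=
  exists U : set 'rV[R]_N,
    [/\ U `<=` @config_space R N,
        open U,
        @config_space R N `<=` closure U
      & forall theta, U theta -> differentials_independent w theta].

(* Main.v *)
From HB Require Import structures.
Require Import Defs.
From mathcomp Require Import all_boot all_order all_algebra all_fingroup.
From mathcomp Require Import all_classical all_reals all_analysis.
From mathcomp Require Import ring lra zify.

Set Implicit Arguments.
Unset Strict Implicit.
Unset Printing Implicit Defensive.

Import Order.TTheory GRing.Theory Num.Theory.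
Import numFieldNormedType.Exports.

Local Open Scope classical_set_scope.
Local Open Scope ring_scope.

(** Along every direction v the logarithmic differential of Psi_{q1,q2} is
    L_{q1} v - L_{q2} v, where L_q sums cot((a - b)/2) (v_a - v_b) / 2 over the
    edges of the cycle q. On the three fields v_j = 1, cos theta_j, sin theta_j
    (the infinitesimal Moebius transformations of the circle) L_q does not
    depend on q, so all the differentials live in a space of dimension N - 3.
    Conversely, transposing two neighbours in the cycle 1, ..., N gives the
    cross-ratios of consecutive quadruples; the last coordinate of each
    quadruple is new, so these N - 3 functions have a triangular Jacobian with
    nonzero diagonal everywhere on the configuration space. *)

(** * Zeros of sine and the configuration space *)

Lemma continuous_half_gap (R : realType) (N : nat) (a b : 'I_N) :
  continuous (fun th : 'rV[R]_N => (th ord0 a - th ord0 b) / 2).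
Proof.
move=> th; apply: (@continuousM _ _ (fun t : 'rV[R]_N => t ord0 a - t ord0 b)
  (fun=> 2^-1)); last exact: cst_continuous.
by apply: (@continuousB _ _ _ (fun t : 'rV[R]_N => t ord0 a)
  (fun t : 'rV[R]_N => t ord0 b)); apply: coord_continuous.
Qed.

Lemma sinMz_pi (R : realType) (k : int) : sin (k%:~R * pi : R) = 0.
Proof.
suff H (n : nat) : sin (n%:R * pi : R) = 0.
  by case: k => n; rewrite ?NegzE ?mulrNz ?mulNr ?sinN H ?oppr0.
rewrite mulr_natl -[_ *+ n]add0r; elim: n => [|n IH].
  by rewrite mulr0n addr0 sin0.
by rewrite mulrSr addrA sinDpi IH oppr0.
Qed.

Lemma cosMz_pi_neq0 (R : realType) (k : int) : cos (k%:~R * pi : R) != 0.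
Proof.
apply/eqP => c0; have := cos2Dsin2 (k%:~R * pi : R).
by rewrite c0 sinMz_pi expr0n addr0 => /eqP; rewrite eq_sym oner_eq0.
Qed.

(** Removing [floor (x / pi)] multiples of [pi] leaves a remainder in [[0, pi)], where sine vanishes
    only at 0; the factor [cos (k * pi)] that appears is nonzero. *)
Lemma sin_eq0P (R : realType) (x : R) :
  sin x = 0 <-> exists k : int, x = k%:~R * pi.
Proof.
split=> [sx0|[k ->]]; last exact: sinMz_pi.
exists (Num.floor (x / pi)); set k := Num.floor _.
have xE : x = (x - k%:~R * pi) + k%:~R * pi by ring.
have /andP[k1 k2] := mem_rg1_floor (x / pi).
have pi0 := pi_gt0 R.
move: k1; rewrite ler_pdivlMr // => k1; move: k2; rewrite ltr_pdivrMr // => k2.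
move: sx0; rewrite {1}xE sinD sinMz_pi mulr0 addr0.
move=> /eqP; rewrite mulf_eq0 (negPf (cosMz_pi_neq0 _ _)) orbF => /eqP s0.
move: k1; rewrite le_eqVlt => /orP[/eqP <-//|k1].
have : 0 < sin (x - k%:~R * pi).
  apply: sin_gt0_pi; apply/andP; split; first by rewrite subr_gt0.
  by move: k2; rewrite mulrDl mul1r -/k; lra.
by rewrite s0 ltxx.
Qed.

Lemma config_spaceP (R : realType) (N : nat) (theta : 'rV[R]_N) :
  config_space theta <->
  forall i j : 'I_N, i != j -> sin ((theta ord0 i - theta ord0 j) / 2) != 0.
Proof.
split=> H i j ij.
  apply/eqP => /sin_eq0P[k kE]; apply: (H i j ij); exists k.
  by rewrite mulrCA -kE; field.
move=> [k kE]; move/eqP: (H i j ij); apply; rewrite kE.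
by apply/sin_eq0P; exists k; field.
Qed.

Lemma open_config_space (R : realType) (N : nat) : open (@config_space R N).
Proof.
rewrite openE => th /config_spaceP H; rewrite /interior /=.
have sin_near : nbhs th [set t : 'rV[R]_N | forall p : 'I_N * 'I_N,
    p.1 != p.2 -> sin ((t ord0 p.1 - t ord0 p.2) / 2) != 0].
  apply: (@filter_forall 'rV[R]_N _ (fun p => [set t : 'rV[R]_N | p.1 != p.2 ->
    sin ((t ord0 p.1 - t ord0 p.2) / 2) != 0]) (nbhs th)) => -[i j] /=.
  have [->|ij] := eqVneq i j; first by apply: filterE => t.
  suff H' : nbhs th [set t : 'rV[R]_N | sin ((t ord0 i - t ord0 j) / 2) != 0].
    by apply: filterS H' => t ? _.
  apply: (@cvgr_neq0 _ _ 'rV[R]_N (nbhs th) _ (fun t : 'rV[R]_N =>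
    sin ((t ord0 i - t ord0 j) / 2)) _ _ (H i j ij)).
  apply: continuous_comp; last exact: continuous_sin.
  exact: continuous_half_gap.
apply: filterS sin_near => t Ht; apply/config_spaceP => i j ij.
by have := Ht (i, j); apply.
Qed.

Lemma config_space_nonempty (R : realType) (N : nat) :
  @config_space R N !=set0.
Proof.
(* All these angles lie in [[0, 1)], so half of a positive gap stays strictly between 0 and [pi]. *)
exists (\row_(i < N) (i%:R / N%:R)); apply/config_spaceP => i j ij; rewrite !mxE.
wlog lt_ij : i j ij / (j < i)%N.
  move=> H; case: (ltngtP i j) => [lt_ij|lt_ij|/val_inj eij].
  - by rewrite -opprB mulNr sinN oppr_eq0; apply: H; rewrite // eq_sym.
  - exact: H.
  - by rewrite eij eqxx in ij.
have N0 : 0 < N%:R :> R by rewrite ltr0n; apply: leq_ltn_trans (ltn_ord i).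
apply: lt0r_neq0; apply: sin_gt0_pi; have pi2 := pi_ge2 R.
rewrite -mulrBl; set x := _ / N%:R.
have x0 : 0 < x by rewrite divr_gt0 // subr_gt0 ltr_nat.
have x1 : x < 1.
  rewrite ltr_pdivrMr // mul1r ltrBlDr -natrD ltr_nat.
  exact: ltn_addr (ltn_ord i).
by apply/andP; split; lra.
Qed.

(** * Logarithmic differentials *)

(** [l] plays the role of [df / f], the differential of [log |f|], with no logarithm or sign
    condition; products turn into sums. *)
Definition has_log_diff (R : realType) (V : normedModType R)
    (x : V) (f : V -> R) (l : V -> R) : Prop :=
  [/\ differentiable f x, f x != 0 & forall v, 'd f x v = f x * l v].

Section LogDiff.
Variables (R : realType) (V : normedModType R) (x : V).

Lemma has_log_diffM (f g l m : V -> R) :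
  has_log_diff x f l -> has_log_diff x g m ->
  has_log_diff x (fun y => f y * g y) (fun v => l v + m v).
Proof.
move=> [df f0 fE] [dg g0 gE].
split; [exact: differentiableM | exact: mulf_neq0 |].
move=> v; have -> : 'd (fun y => f y * g y) x v = f x * 'd g x v + g x * 'd f x v.
  by have := diffM df dg => /(congr1 (fun h => h v)).
by rewrite fE gE; ring.
Qed.

Lemma has_log_diffV (f l : V -> R) :
  has_log_diff x f l -> has_log_diff x (fun y => (f y)^-1) (fun v => - l v).
Proof.
move=> [df f0 fE].
split; [exact: differentiableV | by rewrite invr_eq0 |].
move=> v; have -> : 'd (fun y => (f y)^-1) x v = - (f x) ^- 2 * 'd f x v.
  by have := diffV df f0 => /(congr1 (fun h => h v)).
by rewrite fE; field.
Qed.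

Lemma has_log_diff1 : has_log_diff x (fun=> 1) (fun=> 0).
Proof.
split; [exact: differentiable_cst | exact: oner_neq0 |].
by move=> v; rewrite mulr0; have := diff_cst (1 : R) x => /(congr1 (fun h => h v)).
Qed.

Lemma has_log_diff_prod (I : Type) (r : seq I) (f l : I -> V -> R) :
  (forall i, has_log_diff x (f i) (l i)) ->
  has_log_diff x (fun y => \prod_(i <- r) f i y) (fun v => \sum_(i <- r) l i v).
Proof.
move=> H; elim: r => [|i r IH].
  under [X in has_log_diff _ X]eq_fun do rewrite big_nil.
  under [X in has_log_diff _ _ X]eq_fun do rewrite big_nil.
  exact: has_log_diff1.
under [X in has_log_diff _ X]eq_fun do rewrite big_cons.
under [X in has_log_diff _ _ X]eq_fun do rewrite big_cons.
exact: has_log_diffM.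
Qed.

End LogDiff.

(** * The logarithmic differential of [Psi] as a difference of cycle forms *)

Definition cot_half (R : realType) (a b : R) : R :=
  cos ((a - b) / 2) / sin ((a - b) / 2).

Lemma has_log_diff_sin (R : realType) (N : nat) (a b : 'I_N) (theta : 'rV[R]_N) :
  sin ((theta ord0 a - theta ord0 b) / 2) != 0 ->
  has_log_diff theta (fun th => sin ((th ord0 a - th ord0 b) / 2))
    (fun v => cot_half (theta ord0 a) (theta ord0 b) * (v ord0 a - v ord0 b) / 2).
Proof.
move=> s0.
pose g (th : 'rV[R]_N) := (th ord0 a - th ord0 b) / 2.
have glin : linear g by move=> u y z; rewrite /g !mxE /= /GRing.scale /=; field.
(* Packed as a continuous linear map, the half gap is its own differential. *)
pose gM := GRing.isLinear.Build _ _ _ _ _ glin.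
pose gL : {linear _ -> _} := HB.pack g gM.
have gc : continuous gL.
  exact: continuous_half_gap.
have dg : differentiable g theta := linear_differentiable theta gc.
have ds : differentiable (@sin R) (g theta).
  by apply/derivable1_diffP; exact: derivable_sin.
split=> //; first exact: (differentiable_comp dg ds).
move=> v.
have -> : 'd (sin \o g) theta v = 'd (@sin R) (g theta) ('d g theta v).
  by rewrite (diff_comp dg ds).
have -> : 'd g theta v = g v by rewrite (@diff_lin _ _ _ gL theta gc).
rewrite diff1E // derive1E (@derive_val _ _ _ _ _ _ _ (is_derive_sin _)).
rewrite /cot_half /g /GRing.scale /=; field; exact: s0.
Qed.

Definition cycle_form (R : realType) (N : nat) (q : 'S_N)
    (theta v : 'rV[R]_N) : R :=
  \sum_(j < N) cot_half (theta ord0 (q j)) (theta ord0 (q (ordS j))) *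
    (v ord0 (q j) - v ord0 (q (ordS j))) / 2.

Lemma val_ordS (n : nat) (i : 'I_n) :
  val (ordS i) = if i.+1 == n then 0%N else i.+1.
Proof.
rewrite /=; case: eqP => [->|ne]; first exact: modnn.
by rewrite modn_small // ltn_neqAle ltn_ord andbT; apply/eqP.
Qed.

Lemma val_ord_pred (n : nat) (i : 'I_n) : (0 < i)%N -> val (ord_pred i) = i.-1.
Proof.
case: i => -[|i] //= lt_in _; rewrite modnDr modn_small //.
exact: ltnW.
Qed.

Lemma ordS_neq (n : nat) (i : 'I_n) : (1 < n)%N -> i != ordS i.
Proof.
move=> n1; apply/negP => /eqP /(congr1 val); rewrite val_ordS /=.
by case: eqP => [en|_] e; lia.
Qed.

Section CycleForm.
Variables (R : realType) (N : nat) (theta : 'rV[R]_N).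
Hypotheses (N_gt1 : (1 < N)%N) (theta_config : config_space theta).

Lemma sin_half_gap_neq0 (i j : 'I_N) : i != j ->
  sin ((theta ord0 i - theta ord0 j) / 2) != 0.
Proof. by have /config_spaceP := theta_config; apply. Qed.

(** The minus sign comes from [psi] being the inverse of the product of sines. *)
Lemma has_log_diff_psi (q : 'S_N) :
  has_log_diff theta (psi q) (fun v => - cycle_form q theta v).
Proof.
apply: has_log_diffV; apply: has_log_diff_prod => j.
apply: has_log_diff_sin; apply: sin_half_gap_neq0.
by rewrite (inj_eq perm_inj) ordS_neq.
Qed.

Lemma has_log_diff_Psi (q1 q2 : 'S_N) :
  has_log_diff theta (Psi q1 q2)
    (fun v => cycle_form q1 theta v - cycle_form q2 theta v).
Proof.
have [D0 D1 D2] := has_log_diffM (has_log_diff_psi q2)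
  (has_log_diffV (has_log_diff_psi q1)).
split=> // v; rewrite /Psi D2; ring.
Qed.

End CycleForm.

(** * Cycle forms on Moebius fields and on basis vectors *)

(** With [a = e + d] and [b = e - d], both [cos a - cos b] and [sin a - sin b] contain the factor
    [sin d], which cancels the denominator. What remains is a sum of one function over the two
    endpoints. *)
Lemma cot_half_sumE (R : realType) (a b s c : R) : sin ((a - b) / 2) != 0 ->
  cot_half a b * ((c * cos a + s * sin a) - (c * cos b + s * sin b)) =
  s * (cos a + cos b) - c * (sin a + sin b).
Proof.
rewrite /cot_half => d0.
have aE : a = (a + b) / 2 + (a - b) / 2 by field.
have bE : b = (a + b) / 2 - (a - b) / 2 by field.
set d := (a - b) / 2 in d0 aE bE *; set e := (a + b) / 2 in aE bE *.
by clearbody d e; rewrite aE bE !cosB !sinB !cosD !sinD; field.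
Qed.

(** Each edge contributes half of [g] at each endpoint and each vertex lies on two edges, so the
    total does not see the order [q]. The constant [a] cancels in the differences. *)
Lemma cycle_form_trig (R : realType) (N : nat) (theta v : 'rV[R]_N)
    (a c s : R) (q : 'S_N) :
  (1 < N)%N -> config_space theta ->
  (forall j, v ord0 j = a + (c * cos (theta ord0 j) + s * sin (theta ord0 j))) ->
  cycle_form q theta v =
  \sum_(j < N) (s * cos (theta ord0 j) - c * sin (theta ord0 j)).
Proof.
move=> N1 config vE; pose g j := s * cos (theta ord0 j) - c * sin (theta ord0 j).
transitivity (\sum_(j < N) (g (q j) / 2 + g (q (ordS j)) / 2)).
  apply: eq_bigr => j _; rewrite !vE.
  have n0 : sin ((theta ord0 (q j) - theta ord0 (q (ordS j))) / 2) != 0.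
    by apply: sin_half_gap_neq0; rewrite // (inj_eq perm_inj) ordS_neq.
  have := cot_half_sumE s c n0; rewrite /g => E.
  by rewrite opprD addrACA subrr add0r E; field.
pose G j := g j / 2.
have nextI : injective (fun j => q (ordS j)) by move=> x y /perm_inj /ordS_inj.
rewrite big_split /= -(reindex_inj nextI (P := xpredT) (F := G)) /=.
rewrite -(reindex_inj (@perm_inj _ q) (P := xpredT) (F := G)) /=.
by rewrite -big_split /=; apply: eq_bigr => j _; rewrite /G /g; field.
Qed.

Lemma sum_mul_pred1 (R : pzRingType) (I : finType) (F : I -> R) (p : I) :
  \sum_i F i * (i == p)%:R = F p.
Proof.
rewrite (bigD1 p) //= eqxx mulr1 big1 ?addr0 // => i /negPf ->.
by rewrite mulr0.
Qed.

Lemma cot_halfC (R : realType) (a b : R) : cot_half b a = - cot_half a b.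
Proof. by rewrite /cot_half -opprB mulNr sinN cosN invrN mulrN. Qed.

(** Only the edges leaving and entering position [p] involve [m]; oddness of the cotangent lets both
    start at [m]. *)
Lemma cycle_form_delta (R : realType) (N : nat) (theta : 'rV[R]_N) (q : 'S_N)
    (m p : 'I_N) : q p = m ->
  cycle_form q theta (delta_mx ord0 m) =
  (cot_half (theta ord0 m) (theta ord0 (q (ordS p))) +
   cot_half (theta ord0 m) (theta ord0 (q (ord_pred p)))) / 2.
Proof.
move=> <-; pose C j := cot_half (theta ord0 (q j)) (theta ord0 (q (ordS j))) / 2.
transitivity (\sum_j C j * (j == p)%:R - \sum_j C j * (j == ord_pred p)%:R).
  rewrite -sumrB; apply: eq_bigr => j _; rewrite !mxE !(inj_eq perm_inj) /=.
  rewrite (can2_eq (@ordSK _) (@ord_predK _)) /C; ring.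
by rewrite !sum_mul_pred1 /C ord_predK [in X in _ - X]cot_halfC; field.
Qed.

(** * Independence of differentials through the rank of the Jacobian *)

Lemma diff_rowE (R : realType) (N : nat) (f : 'rV[R]_N -> R) (theta v : 'rV[R]_N) :
  'd f theta v = \sum_j v ord0 j * 'd f theta (delta_mx ord0 j).
Proof.
rewrite {1}[v]row_sum_delta linear_sum; apply: eq_bigr => j _.
by rewrite linearZ.
Qed.

Section Jacobian.
Variables (R : realType) (N m : nat).
Variables (w : 'I_m -> 'rV[R]_N -> R) (theta : 'rV[R]_N).

Lemma differentials_independent_minor (f : 'I_m -> 'I_N) :
  \matrix_(i < m, j < m) 'd (w i) theta (delta_mx ord0 (f j)) \in unitmx ->
  differentials_independent w theta.
Proof.
set J := (X in X \in unitmx) => Junit c H.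
have cJ0 : (\row_i c i) *m J = 0.
  apply/rowP => j; rewrite !mxE -[RHS](H (delta_mx ord0 (f j))).
  by apply: eq_bigr => i _; rewrite !mxE.
have c0 : \row_i c i = 0 by rewrite -(mulmxK Junit (\row_i c i)) cJ0 mul0mx.
by move=> i; have := congr1 (fun u : 'rV_m => u ord0 i) c0; rewrite !mxE.
Qed.

(** Independence gives the Jacobian rank [m]; its product with the transpose of [K] is zero, so the
    two ranks add up to at most [N]. *)
Lemma differentials_independent_bound (k : nat) (K : 'M[R]_(k, N)) :
  row_free K -> (forall i j, 'd (w i) theta (row j K) = 0) ->
  differentials_independent w theta -> (m + k <= N)%N.
Proof.
move=> Kfree wK0 indep.
pose A := \matrix_(i < m, j < N) 'd (w i) theta (delta_mx ord0 j).
have Afree : row_free A.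
  apply: inj_row_free => u uA0; apply/rowP => i; rewrite mxE.
  apply: (indep (u ord0)) => v.
  under eq_bigr do rewrite diff_rowE mulr_sumr.
  rewrite exchange_big big1 //= => j _.
  transitivity (v ord0 j * (u *m A) ord0 j); last by rewrite uA0 mxE mulr0.
  by rewrite mxE mulr_sumr; apply: eq_bigr => l _; rewrite mxE mulrCA.
have AK0 : A *m K^T = 0.
  apply/matrixP => i j; rewrite !mxE -[RHS](wK0 i j) diff_rowE.
  by apply: eq_bigr => l _; rewrite !mxE mulrC.
have := mulmx0_rank_max AK0.
by rewrite mxrank_tr (eqP Afree) (eqP Kfree).
Qed.

End Jacobian.

(** * Upper bound: three independent directions killed by all differentials *)

Definition mobius_mx (R : realType) (N : nat) (theta : 'rV[R]_N) : 'M[R]_(3, N) :=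
  \matrix_(k < 3, j < N) [tuple 1; cos (theta ord0 j); sin (theta ord0 j)]`_k.

(** A nonzero [a + c cos + s sin] has at most two zeros on the circle, and three distinct points are
    available. *)
Lemma mobius_mx_row_free (R : realType) (N : nat) (theta : 'rV[R]_N) :
  (3 <= N)%N -> config_space theta -> row_free (mobius_mx theta).
Proof.
move=> N3 config; apply: inj_row_free => u uK0.
set a := u ord0 0; set c := u ord0 1; set s := u ord0 2%:R.
have trig0 j : a + (c * cos (theta ord0 j) + s * sin (theta ord0 j)) = 0.
  have := congr1 (fun x : 'rV_N => x ord0 j) uK0.
  by rewrite !mxE !big_ord_recl big_ord0 !mxE /= mulr1 addr0 => <-;
    do 2![congr (_ + _)]; congr (u _ _ * _); apply: val_inj.
have H0 : (0 < N)%N by lia.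
have H1 : (1 < N)%N by lia.
pose i0 := Ordinal H0; pose i1 := Ordinal H1; pose i2 := Ordinal N3.
(* Subtract the relations at [i0] and [j] and divide by twice the sine of the half gap. *)
have chord (j : 'I_N) : i0 != j ->
    s * cos ((theta ord0 i0 + theta ord0 j) / 2) =
    c * sin ((theta ord0 i0 + theta ord0 j) / 2).
  move=> ij; have d0 := sin_half_gap_neq0 config ij.
  move: (trig0 i0) (trig0 j) d0.
  set x := theta ord0 i0; set y := theta ord0 j.
  have xE : x = (x + y) / 2 + (x - y) / 2 by field.
  have yE : y = (x + y) / 2 - (x - y) / 2 by field.
  set d := (x - y) / 2 in xE yE *; set e := (x + y) / 2 in xE yE *.
  clearbody d e; rewrite xE yE cosB sinB cosD sinD => E1 E2 d0.
  apply: (mulIf d0); apply: (mulfI (x := 2%:R)); first by rewrite pnatr_eq0.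
  apply/eqP; rewrite -subr_eq0; apply/eqP.
  by rewrite -[RHS](subrr 0) -{1}E1 -E2; ring.
have n01 : i0 != i1 by [].
have n02 : i0 != i2 by [].
have n12 : i1 != i2 by [].
have gap12 := sin_half_gap_neq0 config n12.
move: (chord _ n01) (chord _ n02).
set x := (_ + _) / 2; set y := (_ + _) / 2.
(* The two equations form a linear system in [c], [s] whose determinant is, up to sign,
   [sin (x - y)], hence nonzero. *)
have xyE : (theta ord0 i1 - theta ord0 i2) / 2 = x - y by rewrite /x /y; field.
rewrite xyE sinB in gap12 => E1 E2.
have c0 : c = 0.
  apply: (mulIf gap12); rewrite mul0r.
  transitivity (c * sin x * cos y - c * sin y * cos x); first by ring.
  by rewrite -E1 -E2; ring.
have s0 : s = 0.
  apply: (mulIf gap12); rewrite mul0r.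
  transitivity (s * cos y * sin x - s * cos x * sin y); first by ring.
  by rewrite E1 E2; ring.
have a0 : a = 0 by have := trig0 i0; rewrite c0 s0 !mul0r !addr0.
apply/rowP => k; rewrite mxE.
case: k => -[|[|[|//]]] lt_k3.
- by rewrite -[RHS]a0; congr (u _ _); apply: val_inj.
- by rewrite -[RHS]c0; congr (u _ _); apply: val_inj.
- by rewrite -[RHS]s0; congr (u _ _); apply: val_inj.
Qed.

Lemma diff_Psi_mobius (R : realType) (N : nat) (theta : 'rV[R]_N)
    (w : 'rV[R]_N -> R) (k : 'I_3) :
  (1 < N)%N -> config_space theta -> Psi_set w ->
  'd w theta (row k (mobius_mx theta)) = 0.
Proof.
move=> N1 config [q1 [q2 ->]].
have [_ _ ->] := has_log_diff_Psi N1 config q1 q2.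
have [a [c [s E]]] : exists a c s, forall j, (row k (mobius_mx theta)) ord0 j =
    a + (c * cos (theta ord0 j) + s * sin (theta ord0 j)).
  case: k => -[|[|[|//]]] lt_k3.
  - by exists 1, 0, 0 => j; rewrite !mxE /=; ring.
  - by exists 0, 1, 0 => j; rewrite !mxE /=; ring.
  - by exists 0, 0, 1 => j; rewrite !mxE /=; ring.
by rewrite !(cycle_form_trig _ N1 config E) subrr mulr0.
Qed.

(** * Lower bound: cross-ratios with a triangular Jacobian *)

(* Exchanging two neighbours b, c in the stretch a, b, c, d of the cycle
   1, ..., N turns Psi into a cross-ratio of the four points a, b, c, d. *)
Definition cross_perm (n : nat) (i : 'I_n.+1) : 'S_n.+4 :=
  tperm (inord i.+1) (inord i.+2).

(** Since [i <= n], the index stays below [n + 4], so [inord] never falls back on its default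
    value. *)
Lemma val_inord4 (n k : nat) (i : 'I_n.+1) : (k <= 3)%N ->
  val (inord (k + i) : 'I_n.+4) = (k + i)%N.
Proof. by move=> k3; apply: inordK; have := ltn_ord i; lia. Qed.

Lemma cross_perm_fix (n : nat) (i : 'I_n.+1) (j : 'I_n.+4) :
  (j < i.+1)%N || (i.+2 < j)%N -> cross_perm i j = j.
Proof.
move=> ji; apply: tpermD; apply/negP => /eqP /(congr1 val).
  by rewrite (@val_inord4 _ 1) //= => e; lia.
by rewrite (@val_inord4 _ 2) //= => e; lia.
Qed.

(** The successor may wrap around to 0, which lies below [i + 1] and is fixed as well. *)
Lemma cross_perm_ordS (n : nat) (i : 'I_n.+1) (m : 'I_n.+4) :
  (i.+2 < m)%N -> cross_perm i (ordS m) = ordS m.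
Proof.
move=> im; apply: cross_perm_fix; rewrite val_ordS.
by case: eqP => _ //=; rewrite (ltn_trans im) ?orbT.
Qed.

(** Beyond [i + 3], the label [m] and both its neighbours are fixed, so the two cycles share their
    edges at [m]. This gives the zeros above the diagonal. *)
Lemma cycle_form_cross_perm (R : realType) (n : nat) (theta : 'rV[R]_n.+4)
    (i : 'I_n.+1) (m : 'I_n.+4) :
  (i.+3 < m)%N ->
  cycle_form (cross_perm i) theta (delta_mx ord0 m) =
  cycle_form 1%g theta (delta_mx ord0 m).
Proof.
move=> im; have im' := ltnW im.
have qm : cross_perm i m = m by apply: cross_perm_fix; rewrite im' orbT.
rewrite (cycle_form_delta _ qm) (cycle_form_delta _ (perm1 m)) !perm1.
rewrite cross_perm_ordS // cross_perm_fix // val_ord_pred; last exact: leq_ltn_trans im.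
by apply/orP; right; lia.
Qed.

(** The numerator of the difference of the two cotangents is, up to sign, [sin ((b - c) / 2)]. *)
Lemma cot_half_inj (R : realType) (a b c : R) :
  sin ((a - b) / 2) != 0 -> sin ((a - c) / 2) != 0 ->
  cot_half a b = cot_half a c -> sin ((b - c) / 2) = 0.
Proof.
rewrite /cot_half => b0 c0 /eqP; rewrite eqr_div // => /eqP E.
have -> : (b - c) / 2 = (a - c) / 2 - (a - b) / 2 by field.
by rewrite sinB -E; ring.
Qed.

(** At label [i + 3] the successor is common, but the predecessor is [i + 1] in one cycle and
    [i + 2] in the other. Equal forms would make these two points congruent. This gives the nonzero
    diagonal. *)
Lemma cycle_form_cross_perm_neq (R : realType) (n : nat) (theta : 'rV[R]_n.+4)
    (i : 'I_n.+1) : config_space theta ->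
  cycle_form (cross_perm i) theta (delta_mx ord0 (inord i.+3)) !=
  cycle_form 1%g theta (delta_mx ord0 (inord i.+3)).
Proof.
move=> config; set m := inord _.
have mE : val m = i.+3 by exact: (@val_inord4 _ 3).
have bE : val (inord i.+1 : 'I_n.+4) = i.+1 by exact: (@val_inord4 _ 1).
have cE : val (inord i.+2 : 'I_n.+4) = i.+2 by exact: (@val_inord4 _ 2).
have im : (i.+2 < m)%N by rewrite [X in (_ < X)%N]mE.
have pE : ord_pred m = inord i.+2.
  by apply: val_inj; rewrite cE val_ord_pred ?[nat_of_ord m]mE.
have qm : cross_perm i m = m by apply: cross_perm_fix; rewrite im orbT.
rewrite (cycle_form_delta _ qm) (cycle_form_delta _ (perm1 m)) !perm1.
rewrite cross_perm_ordS // pE /cross_perm tpermR.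
apply/negP => /eqP E.
have {}E : cot_half (theta ord0 m) (theta ord0 (inord i.+1)) =
           cot_half (theta ord0 m) (theta ord0 (inord i.+2)) by lra.
have gap (j l : 'I_n.+4) : val j != val l ->
    sin ((theta ord0 j - theta ord0 l) / 2) != 0.
  by move=> jl; apply: sin_half_gap_neq0 => //; apply: contra_neq jl => ->.
have := gap (inord i.+1) (inord i.+2); rewrite bE cE (cot_half_inj _ _ E) ?eqxx.
- by rewrite neq_ltn ltnSn => /(_ isT).
- by apply: gap; rewrite mE bE; lia.
- by apply: gap; rewrite mE cE; lia.
Qed.

Lemma cross_perm_independent (R : realType) (n : nat) (theta : 'rV[R]_n.+4) :
  config_space theta ->
  differentials_independent
    (fun i : 'I_n.+1 => @Psi R n.+4 (cross_perm i) 1%g) theta.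
Proof.
move=> config.
apply: (differentials_independent_minor (f := fun j : 'I_n.+1 => inord j.+3)).
set J := (X in X \in unitmx).
(* The factor is the nonzero value of [Psi], so only the differences of cycle forms matter. *)
have JE i j : exists2 x, x != 0 & J i j = x *
    (cycle_form (cross_perm i) theta (delta_mx ord0 (inord j.+3)) -
     cycle_form 1%g theta (delta_mx ord0 (inord j.+3))).
  have [_ x0 E] := has_log_diff_Psi (isT : 1 < n.+4)%N config (cross_perm i) 1%g.
  by exists (Psi (cross_perm i) 1%g theta); rewrite // mxE E.
have Jtrig : is_trig_mx J.
  apply/is_trig_mxP => i j ij; have [x _ ->] := JE i j.
  rewrite cycle_form_cross_perm ?subrr ?mulr0 //.
  by rewrite [X in (_ < X)%N](@val_inord4 _ 3).
rewrite unitmxE det_trig // unitfE; apply/prodf_neq0 => i _.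
have [x x0 ->] := JE i i.
by rewrite mulf_neq0 // subr_eq0 cycle_form_cross_perm_neq.
Qed.

(** * The exact count *)

Theorem mainTheorem5 (R : realType) (N : nat) (hN : (4 <= N)%N) :
  (exists w : 'I_(N - 3) -> 'rV[R]_N -> R,
     (forall i, Psi_set (w i)) /\ functionally_independent w) /\
  ~ (exists w : 'I_(N - 2) -> 'rV[R]_N -> R,
     (forall i, Psi_set (w i)) /\ functionally_independent w).
Proof.
split.
  case: N hN => [|[|[|[|n]]]] // _.
  exists (fun i : 'I_n.+1 => @Psi R n.+4 (cross_perm i) 1%g); split.
    by move=> i; exists (cross_perm i), 1%g.
  exists (@config_space R n.+4); split=> //.
  - exact: open_config_space.
  - exact: subset_closure.
  - exact: cross_perm_independent.
move=> [w [wPsi [U [U_config Uopen Udense Uindep]]]].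
(* Density yields a point of [U] because the configuration space is nonempty. *)
have [theta Utheta] : U !=set0.
  have [x config_x] := config_space_nonempty R N.
  by have [theta [Utheta _]] := Udense _ config_x setT filterT; exists theta.
have config := U_config _ Utheta.
have N1 : (1 < N)%N by exact: leq_trans hN.
(* At this point the bound reads [(N - 2) + 3 <= N], which is absurd. *)
have := differentials_independent_bound
  (mobius_mx_row_free (ltnW hN) config)
  (fun i j => diff_Psi_mobius j N1 config (wPsi i)) (Uindep _ Utheta).
by lia.
Qed.
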